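(* Let $I_0=[t_0,t_0+L]$ ($L>0$), $r\ge 0$, $I_-=[t_0-r,t_0]$, $I=I_-\cup I_0$. Let $f:I\times\mathbb{R}^2\to\mathbb{R}$ be a Carathéodory function, $\tau:I_0\to I$ a function, $\Lambda:\mathcal{C}(I)\to\mathbb{R}$ a (possibly nonlinear) operator and $k\in\mathcal{C}(I_-)$, and consider the problem $$(P)\qquad x'(t)=f(t,x(t),x(\tau(t)))\ \text{ for a.a. } t\in I_0,\qquad x(t)=\Lambda(x)+k(t)\ \text{ for all } t\in I_-.$$ Assume that: 1. There exist $\alpha,\beta\in\mathcal{C}(I)$, with $\alpha\le\beta$ on $I$, which are a lower and an upper solution for problem $(P)$ (in the sense defined in the context). Put $E(t)=[\alpha(\tau(t)),\beta(\tau(t))]$ for $t\in I_0$. 2. (a) For all $x,y\in[\min_{t\in I}\alpha(t),\max_{t\in I}\beta(t)]$ the function $f(\cdot,x,y)$ is measurable, and for a.a. $t\in I_0$, all $x\in[\alpha(t),\beta(t)]$ and all $y\in E(t)$ the functions $f(t,\cdot,y)$ and $f(t,x,\cdot)$ are continuous. (b) The function $\tau$ is measurable. (c) The operator $\Lambda:\mathcal{C}(I)\to\mathbb{R}$ is continuous. 3. There exists $\psi\in L^1(I_0)$ such that for a.a. $t\in I_0$, all $x\in[\alpha(t),\beta(t)]$ and all $y\in E(t)$ we have $|f(t,x,y)|\le\psi(t)$. 4. $f$ is nondecreasing with respect to its third variable, and $\Lambda$ is nondecreasing in $[\alpha,\beta]$ (that is, $\gamma_1,\gamma_2\in[\alpha,\beta]$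 and $\gamma_1\le\gamma_2$ imply $\Lambda(\gamma_1)\le\Lambda(\gamma_2)$). Then problem $(P)$ has the extremal solutions in $[\alpha,\beta]$, that is, it has the greatest solution and the least solution in $[\alpha,\beta]$.
   Context: $\mathcal{C}(J)$ is the set of real continuous functions on the interval $J$, with the topology of uniform convergence when $J=I$; $AC(I_0)$ is the set of absolutely continuous functions on $I_0$; ''a.a.'' means almost all (Lebesgue measure). $f$ Carathéodory means that $f(\cdot,x,y)$ is measurable for each $(x,y)$ and, for a.a. $t$, $f(t,\cdot,\cdot)$ is continuous on $\mathbb{R}^2$. A solution of $(P)$ is a function $x\in\mathcal{C}(I)$ such that $x_{|I_0}\in AC(I_0)$ and $x$ satisfies both relations in $(P)$. Order: for $\gamma_1,\gamma_2\in\mathcal{C}(I)$, $\gamma_1\le\gamma_2$ iff $\gamma_1(t)\le\gamma_2(t)$ for all $t\in I$. $[\alpha,\beta]=\{\gamma\in\mathcal{C}(I):\alpha\le\gamma\le\beta\text{ on }I\}$. For $Y\subset\mathcal{C}(I)$, a solution $x_*\in Y$ is the least (respectively, the greatest) solution in $Y$ if $x_*\le x$ (respectively, $x_*\ge x$) for every other solution $x\in Y$. Lower and upper solutions: functions $\alpha,\beta\in\mathcal{C}(I)$ with $\alpha\le\beta$ on $I$ are a lower and an upper solution for $(P)$ if $\alpha_{|I_0},\beta_{|I_0}\in AC(I_0)$ and $$\alpha'(t)\le\min_{\xi\in E(t)}f(t,\alpha(t),\xi)\ \text{ for a.a. }t\in I_0,\qquad \alpha\le\inf_{\gamma\in[\alpha,\beta]}\Lambda(\gamma)+k\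 \text{ on }I_-,$$ $$\beta'(t)\ge\max_{\xi\in E(t)}f(t,\beta(t),\xi)\ \text{ for a.a. }t\in I_0,\qquad \beta\ge\sup_{\gamma\in[\alpha,\beta]}\Lambda(\gamma)+k\ \text{ on }I_-,$$ where $E(t)=[\alpha(\tau(t)),\beta(\tau(t))]$ for $t\in I_0$. (This implicitly requires $\Lambda$ to be bounded on $[\alpha,\beta]$.) *)

(* Defs.v *)
From HB Require Import structures.
From mathcomp Require Import all_boot all_order all_algebra.
From mathcomp Require Import all_classical all_reals all_analysis.

Set Implicit Arguments.
Unset Strict Implicit.
Unset Printing Implicit Defensive.

Import Order.TTheory GRing.Theory Num.Theory.
Import numFieldNormedType.Exports.

Local Open Scope classical_set_scope.
Local Open Scope ring_scope.

Section real_analysis.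
Variable R : realType.

(* The real line with the Lebesgue measurable sets (as opposed to the Borel
   sets, which are the sigma-algebra carried by R itself); this is the domain
   of completed_lebesgue_measure. *)
Definition lebesgueType := caratheodory_type (@wlength R idfun)^*%mu.

Definition lebesgue_measurable_fun (D : set R) (g : R -> R) : Prop :=
  measurable_fun (D : set lebesgueType) (g : lebesgueType -> R).

Definition L1 (D : set R) (g : R -> R) : Prop :=
  (@completed_lebesgue_measure R).-integrable
    (D : set lebesgueType) (EFin \o g).

Definition for_aa (D : set R) (P : R -> Prop) : Prop :=
  {ae (@lebesgue_measure R), forall t : R, D t -> P t}.

Definition AC (a b : R) (g : R -> R) : Prop :=
  forall e : R, 0 < e -> exists2 d : R, 0 < d &
    forall (n : nat) (u v : 'I_n -> R),
      (forall i, [/\ a <= u i, u i < v i & v i <= b]) ->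
      trivIset [set: 'I_n] (fun i => `]u i, v i[%classic) ->
      \sum_(i < n) (v i - u i) < d ->
      \sum_(i < n) `|g (v i) - g (u i)| < e.

Definition is_min (A : set R) (m : R) : Prop := A m /\ lbound A m.
Definition is_max (A : set R) (m : R) : Prop := A m /\ ubound A m.

End real_analysis.

(* A function on a subset J of the line is represented by any total function
   R -> R, only its restriction to J being relevant; in particular functions
   in C(J) are identified, compared and approximated through their values on J
   only. *)
Section function_spaces.
Variable R : realType.

Definition Cont (J : set R) : set (R -> R) :=
  [set g : R -> R | {within J, continuous g}].

Definition le_on (J : set R) (g1 g2 : R -> R) : Prop :=
  forall t, J t -> g1 t <= g2 t.

Definition order_interval (J : set R) (a b : R -> R) : set (R -> R) :=
  [set g | [/\ Cont J g, le_on J a g & le_on J g b]].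

(* Lam induces a map C(J) -> R, i.e. it does not see values outside J. *)
Definition operator_on (J : set R) (Lam : (R -> R) -> R) : Prop :=
  forall g1 g2, Cont J g1 -> Cont J g2 ->
    (forall t, J t -> g1 t = g2 t) -> Lam g1 = Lam g2.

Definition operator_continuous (J : set R) (Lam : (R -> R) -> R) : Prop :=
  {within (Cont J : set {uniform` J -> R}),
     continuous (Lam : {uniform` J -> R} -> R)}.

Definition operator_nondecreasing_in (J : set R) (Lam : (R -> R) -> R)
    (Y : set (R -> R)) : Prop :=
  forall g1 g2, Y g1 -> Y g2 -> le_on J g1 g2 -> Lam g1 <= Lam g2.

Definition is_least (J : set R) (S : set (R -> R)) (x : R -> R) : Prop :=
  S x /\ forall y, S y -> le_on J x y.

Definition is_greatest (J : set R) (S : set (R -> R)) (x : R -> R) : Prop :=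
  S x /\ forall y, S y -> le_on J y x.

Definition caratheodory (J : set R) (f : R -> R -> R -> R) : Prop :=
  (forall x y, lebesgue_measurable_fun J (fun t => f t x y)) /\
  for_aa J (fun t => continuous (fun p : R * R => f t p.1 p.2)).

End function_spaces.

Section problem.
Variables (R : realType) (t0 r L : R).

Definition I_zero : set R := `[t0, t0 + L]%classic.
Definition I_minus : set R := `[t0 - r, t0]%classic.
Definition I_all : set R := I_minus `|` I_zero.

Variables (f : R -> R -> R -> R) (tau : R -> R).
Variables (Lam : (R -> R) -> R) (k : R -> R).

(* Derivatives below are two-sided; for almost all t in I_zero, t is an interior
   point, where they depend only on the restriction of the function to I_zero. *)
Definition solution (x : R -> R) : Prop :=
  [/\ Cont I_all x,
      AC t0 (t0 + L) x,
      for_aa I_zero (fun t => is_derive t 1 x (f t (x t) (x (tau t))))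
    & forall t, I_minus t -> x t = Lam x + k t].

Definition E_set (alpha beta : R -> R) (t : R) : set R :=
  `[alpha (tau t), beta (tau t)]%classic.

Definition lower_upper_solutions (alpha beta : R -> R) : Prop :=
  let Lam_values := Lam @` order_interval I_all alpha beta in
  [/\ [/\ Cont I_all alpha, Cont I_all beta & le_on I_all alpha beta],
      AC t0 (t0 + L) alpha /\ AC t0 (t0 + L) beta,
      has_lbound Lam_values /\ has_ubound Lam_values,
      for_aa I_zero (fun t => derivable alpha t 1 /\
        exists2 m, is_min (f t (alpha t) @` E_set alpha beta t) m
                 & derive1 alpha t <= m) /\
      (forall t, I_minus t -> alpha t <= inf Lam_values + k t)
    & for_aa I_zero (fun t => derivable beta t 1 /\
        exists2 M, is_max (f t (beta t) @` E_set alpha beta t) M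
                 & M <= derive1 beta t) /\
      (forall t, I_minus t -> sup Lam_values + k t <= beta t)].

End problem.

(* Main.v *)
Require Import Defs.
From mathcomp Require Import all_boot all_order all_algebra.
From mathcomp Require Import all_classical all_reals all_analysis.
From mathcomp Require Import measurable_realfun lra.

Set Implicit Arguments.
Unset Strict Implicit.
Unset Printing Implicit Defensive.

Import Order.TTheory GRing.Theory Num.Theory.
Import numFieldNormedType.Exports.
Import Defs.

Local Open Scope classical_set_scope.
Local Open Scope ring_scope.

(** Fix [gamma] in the order interval [[alpha, beta]] and replace [x (tau t)] by
    [gamma (tau t)] and [Lam x] by [Lam gamma]. What remains is a scalar initial
    value problem [x' = g (t, x)], which has a greatest solution [G gamma] between
    [alpha] and [beta] ([greatest_decoupled_solution]). As [f] and [Lam] are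
    nondecreasing in [gamma], a solution for a smaller [gamma] is a subsolution
    for a larger one, so [G] is monotone. The derivatives of its values are
    bounded by [psi], so all its values share one modulus of continuity, and
    pointwise suprema of functions with that modulus are again continuous. The
    argument of Knaster and Tarski then gives the greatest fixed point of [G],
    which is the greatest solution of the problem ([greatest_solution]). The
    change of variables [x |-> - x] exchanges greatest and least solutions.

    For the scalar problem, [g (t, x)] is replaced by its supremum over the
    window of radius [eta] around [x]. Evaluating this supremum at the slightly
    earlier position [x (t - delta)] gives an equation that is solved by
    integrating stretch by stretch, and its solution is a supersolution with a
    margin: its derivative dominates [g (t, y)] for all [y] within
    [3 / 4 * eta] of its value. Such a margin replaces the Lipschitz condition in
    comparison arguments: a subsolution that starts below has to cross a narrow
    band where the difference has a derivative that is at most [0]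
    ([AC_le0]). Hence all subsolutions stay below the approximate solutions, and
    the approximate solutions decrease as [eta] decreases geometrically; by
    dominated convergence their limit is a solution, the greatest one
    ([greatest_ode_solution]).

    Comparison needs that an absolutely continuous function whose derivative is
    almost everywhere at most [0] does not increase ([AC_le]); this follows from
    a finite partition into short intervals, on which either the derivative
    controls the increment, or the interval lies in a small open neighbourhood of
    the exceptional null set. *)

(** * Absolutely continuous functions *)

Section absolutely_continuous_functions.
Variable R : realType.
Implicit Types (a b c e l t : R) (h : R -> R) (P : R -> Prop).
Local Notation mu := (@lebesgue_measure R).

(** Compactness of [[a, b]] in the form of Cousin's lemma: at each point [c]
    it is enough to propagate [P] across short intervals that contain [c], so
    [P] spreads from [a] to [b] along a finite tagged partition. *)
Lemma cousin_induction P a b : a <= b -> P a ->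
  (forall c, a <= c <= b -> exists2 e, 0 < e &
     forall u v, a <= u -> u <= c -> c <= v -> v <= b -> u < v ->
       c - u < e -> v - c < e -> P u -> P v) ->
  P b.
Proof.
move=> ab Pa step.
pose A := [set t | a <= t <= b /\ P t].
have Aa : A a by split=> //; rewrite lexx.
have ubA : ubound A b by move=> t [/andP[]].
have supA : has_sup A by split; [exists a | exists b].
set c := sup A.
have ac : a <= c by apply: ub_le_sup Aa; exists b.
have cb : c <= b by apply: ge_sup => //; exists a.
have [e e0 ce] := step c (introT andP (conj ac cb)).
have [u [/andP[au ub] Pu] cu] := sup_adherent e0 supA.
have uc : u <= c by apply: ub_le_sup; [exists b | split=> //; rewrite au].
have cue : c - u < e by rewrite -/c in cu; lra.
have Pc : P c.
  move: uc; rewrite le_eqVlt => /predU1P[<-//|uc].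
  by apply: (ce u c) => //; rewrite ?subrr// ltW.
move: cb; rewrite le_eqVlt => /predU1P[<-//|cb].
pose v := Num.min b (c + e / 2).
have cv : c < v by rewrite /v lt_min cb/=; lra.
have vb : v <= b by rewrite /v ge_min lexx.
have vce : v <= c + e / 2 by rewrite /v ge_min lexx orbT.
have : A v.
  split; first by rewrite vb andbT; lra.
  by apply: (ce c v) => //; lra.
by move/(ub_le_sup (ex_intro _ b ubA)); rewrite -/c leNgt cv.
Qed.

Lemma AC_sub a b (g h : R -> R) : AC a b g -> AC a b h ->
  AC a b (fun t => g t - h t).
Proof.
move=> ACg ACh e e0; have e20 : 0 < e / 2 by lra.
have [d1 d10 H1] := ACg _ e20; have [d2 d20 H2] := ACh _ e20.
exists (Num.min d1 d2); first by rewrite lt_min d10.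
move=> n u v uv duv; rewrite lt_min => /andP[s1 s2].
have := H1 n u v uv duv s1; have := H2 n u v uv duv s2 => h2 h1.
suff : \sum_(i < n) `|g (v i) - h (v i) - (g (u i) - h (u i))| <=
       \sum_(i < n) `|g (v i) - g (u i)| + \sum_(i < n) `|h (v i) - h (u i)|.
  by lra.
rewrite -big_split/=; apply: ler_sum => i _.
rewrite -[X in _ <= _ + X]normrN (le_trans _ (ler_normD _ _))//.
by rewrite le_eqVlt; apply/orP; left; apply/eqP; congr `|_|; lra.
Qed.

Lemma AC_subinterval a b a' b' h : a <= a' -> b' <= b ->
  AC a b h -> AC a' b' h.
Proof.
move=> aa bb ACh e /ACh[d d0 H]; exists d => // n u v uv.
by apply: H => i; have [? ? ?] := uv i; split=> //; lra.
Qed.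

Lemma AC_uniformly_continuous a b h e : AC a b h -> 0 < e ->
  exists2 d, 0 < d & forall u v, a <= u -> u <= v -> v <= b -> v - u < d ->
    `|h v - h u| < e.
Proof.
move=> ACh e0; have [d d0 H] := ACh e e0; exists d => // u v au uv vb vud.
move: uv; rewrite le_eqVlt => /predU1P[<-|uv]; first by rewrite subrr normr0.
have := H 1%N (fun=> u) (fun=> v); rewrite !big_ord1; apply => //.
by move=> i j _ _ _; rewrite !ord1.
Qed.


(** The two increments around [t] add up, which is what allows tags in the
    interior of the intervals of a partition. *)
Lemma is_derive_straddle h t l e : is_derive t 1 h l -> 0 < e ->
  exists2 d, 0 < d & forall u v, u <= t -> t <= v -> t - u < d -> v - t < d ->
    h v - h u <= (l + e) * (v - u).
Proof.
move=> [dh hl] e0.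
have : x^-1 *: ((h \o shift t) (x *: (1 : R)) - h t) @[x --> 0^'] --> l.
  by rewrite -hl; exact: dh.
move=> /cvgrPdist_le /(_ e e0); rewrite near_withinE.
move=> /nbhs_ballP[d /= d0 hd].
have incr x : `|x| < d -> `|h (t + x) - h t - l * x| <= e * `|x|.
  have [->|x0 xd] := eqVneq x 0.
    by rewrite !(mulr0, addr0, subrr, normr0).
  have := hd x; rewrite /ball/= sub0r normrN => /(_ xd x0).
  rewrite [x *: 1]mulr1 /= [x + t]addrC distrC => H.
  rewrite -ler_pdivrMr ?normr_gt0// -normfV -normrM.
  apply: le_trans H; rewrite le_eqVlt; apply/orP; left; apply/eqP.
  congr `|_|; rewrite mulrBl mulfK// [_ *: _]mulrC; lra.
exists d => // u v ut tv utd tvd.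
have := incr (v - t); rewrite ger0_norm; last lra.
have := incr (u - t); rewrite ler0_norm; last lra.
rewrite !subrKC !ler_norml => /(_ ltac:(lra)) /andP[? ?] /(_ ltac:(lra)) /andP[? ?].
lra.
Qed.

(** Off a null set the derivative bounds short increments by a small multiple of
    their length. The null set lies in an open set so small that, by absolute
    continuity, the increments over disjoint intervals inside it have a small
    sum. Going from [a] to [b], each short step is of one of these two kinds. *)
Lemma AC_le a b h : a <= b -> AC a b h ->
  for_aa `]a, b[ (fun t => exists2 l, is_derive t 1 h l & l <= 0) ->
  h b <= h a.
Proof.
move=> ab ACh [N [mN N0 subN]].
apply/ler_addgt0Pr => e e0.
pose e1 := e / (2 * (1 + (b - a))).
have ba0 : 0 <= b - a by lra.
have e10 : 0 < e1 by rewrite divr_gt0//; lra.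
have e1ba : e1 * (b - a) <= e / 2.
  rewrite /e1 invfM mulrA -mulrA ler_piMr//; first lra.
  by rewrite mulrC ler_pdivrMr; lra.
have e20 : 0 < e / 2 by lra.
have [d d0 Hd] := ACh _ e20.
(* With the end points in the exceptional set, every other tag is an interior
   point, where the derivative is known. *)
pose N' := N `|` [set a; b].
have mN' : measurable N' by apply: measurableU => //; apply: measurableU.
have N'0 : mu N' = 0%E.
  apply/negligibleP => //; apply: negligibleU; first exact/negligibleP.
  by apply: negligibleU; apply/negligibleP => //; exact: lebesgue_measure_set1.
have N'oo : (mu N' < +oo)%E by rewrite N'0 ltry.
have [U [oU N'U muUN]] := lebesgue_regularity_outer mN' N'oo d0.
have mU : measurable U by exact: open_measurable.
have muU : (mu U < d%:E)%E.
  apply: le_lt_trans muUN; rewrite -[leRHS]adde0 -[in leRHS]N'0.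
  rewrite -{1}[U](setDUK N'U) setUC.
  by apply: measureU2 => //; exact: measurableD.
have le_mu (A B : set R) : measurable A -> measurable B -> A `<=` B ->
    (mu A <= mu B)%E.
  by move=> mA mB; apply: (@le_measure _ _ _ (@lebesgue_measure R)); rewrite inE.
have mUt t : measurable (U `&` `]-oo, t]) by exact: measurableI.
pose m t := fine (mu (U `&` `]-oo, t])).
have mfin t : mu (U `&` `]-oo, t]) = (m t)%:E.
  rewrite fineK// ge0_fin_numE// (le_lt_trans _ (lt_trans muU (ltry _)))//.
  by apply: le_mu => //; exact: subIsetl.
have m_incr u v : u <= v -> `]u, v] `<=` U -> m u + (v - u) <= m v.
  move=> uv uvU; rewrite -lee_fin EFinD -!mfin.
  have -> : (v - u)%:E = mu `]u, v].
    rewrite lebesgue_measure_itv/= lte_fin.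
    by case: ltP => // vu; rewrite (le_anti (introT andP (conj uv vu))) subrr.
  rewrite -measureU; [|exact: mUt|exact: measurable_itv|]; last first.
    rewrite -subset0 => x [[_ /=]]; rewrite !in_itv/= => xu /andP[]; lra.
  apply: le_mu => //; first exact: measurableU.
  move=> x [[Ux]|xuv] /=; last first.
    by split; [exact: uvU|move: xuv; rewrite /= !in_itv/= => /andP[]].
  by rewrite /= !in_itv/= => xu; split=> //=; lra.
(* [s] lists the steps made inside [U], the latest one first; bounding their
   total length by [m t] rather than by the measure of [U] is what makes the
   bound inductive. *)
pose chain (s : seq (R * R)) t :=
  [/\ pairwise (fun p q => q.2 <= p.1) s,
      all (fun p => [&& a <= p.1, p.1 < p.2 & p.2 <= t]) s &
      \sum_(p <- s) (p.2 - p.1) <= m t].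
pose P t := exists2 s, chain s t &
  h t - h a <= e1 * (t - a) + \sum_(p <- s) `|h p.2 - h p.1|.
have : P b.
  apply: (@cousin_induction P a b) => //.
    exists [::]; last by rewrite !big_nil; lra.
    by split; rewrite ?big_nil// fine_ge0.
  move=> c /andP[ac cb].
  have [N'c|N'c] := pselect (N' c).
    have /nbhs_ballP[r /= r0 rU] : nbhs c U by move: oU; rewrite openE; apply; exact: N'U.
    exists r => // u v au uc cv vb uv ucr cvr [s [pw al sm] hs].
    exists ((u, v) :: s); last first.
      rewrite big_cons/=.
      have := ler_norm (h v - h u).
      have : 0 <= e1 * (v - u) by rewrite mulr_ge0; lra.
      by lra.
    split => /=.
    - rewrite pw andbT; apply: sub_all al => p /and3P[]; lra.
    - rewrite au uv lexx/=; apply: sub_all al => p /and3P[-> ->]/=; lra.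
    - rewrite big_cons/= addrC; apply: le_trans (m_incr u v _ _); [lra|lra|].
      move=> x /=; rewrite in_itv/= => /andP[ux xv]; apply: rU.
      by rewrite /ball/= ltr_norml; apply/andP; split; lra.
  have [l dl l0] : exists2 l, is_derive c 1 h l & l <= 0.
    have cab : `]a, b[%classic c.
      rewrite /= in_itv/= !lt_neqAle ac cb !andbT; apply/andP; split.
        by apply/eqP => ca; apply: N'c; right; left.
      by apply/eqP => ca; apply: N'c; right; right.
    by apply: contrapT => H; apply: N'c; left; apply: subN => /= /(_ cab).
  have [r r0 hr] := is_derive_straddle dl e10.
  exists r => // u v au uc cv vb uv ucr cvr [s [pw al sm] hs].
  exists s; last first.
    have : (l + e1) * (v - u) <= e1 * (v - u) by rewrite ler_wpM2r; lra.
    have := hr u v uc cv ucr cvr.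
    by lra.
  split => //.
    by apply: sub_all al => p /and3P[-> ->]/=; lra.
  apply: le_trans sm _; rewrite -lee_fin -!mfin.
  apply: le_mu => //; apply: setIS => x /=; rewrite !in_itv/=.
  by lra.
move=> [s [pw al sm] hb].
have {}sm : \sum_(p <- s) (p.2 - p.1) < d.
  apply: le_lt_trans sm _; rewrite -lte_fin -mfin.
  by apply: le_lt_trans muU; apply: le_mu => //; exact: subIsetl.
suff : \sum_(p <- s) `|h p.2 - h p.1| < e / 2 by lra.
move: sm; rewrite !(big_nth (0, 0)) !big_mkord.
apply: (Hd (size s) (fun i => (nth (0, 0) s i).1) (fun i => (nth (0, 0) s i).2)).
  by move=> i; have /and3P[] := all_nthP (0, 0) al i (ltn_ord i).
have disj (i j : 'I_(size s)) x : (i < j)%N ->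
    `](nth (0, 0) s i).1, (nth (0, 0) s i).2[%classic x ->
    `](nth (0, 0) s j).1, (nth (0, 0) s j).2[%classic x -> False.
  move=> ij /=; rewrite !in_itv/= => /andP[? ?] /andP[? ?].
  have := pairwiseP (0, 0) pw i j (ltn_ord i) (ltn_ord j) ij; lra.
move=> i j _ _ [x [xi xj]]; apply: val_inj => /=.
case: (ltngtP i j) => // ij; exfalso; first exact: disj ij xi xj.
exact: disj ij xj xi.
Qed.

End absolutely_continuous_functions.

(** * Almost everywhere comparison and primitives *)

Section almost_all.
Variable R : realType.
Implicit Types (D : set R) (P Q : R -> Prop).

Lemma for_aa_imply D1 D2 P Q :
  (forall t, (D1 t -> P t) -> D2 t -> Q t) -> for_aa D1 P -> for_aa D2 Q.
Proof.
by move=> PQ; apply: (@filterS _ _ (ae_filter_ringOfSetsType _)).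
Qed.

Lemma for_aaI D P Q : for_aa D P -> for_aa D Q ->
  for_aa D (fun t => P t /\ Q t).
Proof.
apply: (@filterS2 _ _ (ae_filter_ringOfSetsType _)) => t Pt Qt Dt.
by split; [exact: Pt | exact: Qt].
Qed.

End almost_all.

Section comparison.
Variable R : realType.
Implicit Types (a b c e l t : R) (h : R -> R).

(** A derivative estimate on the narrow band where [0 < h < eta] is enough: [h]
    has to cross that band before it can become large. *)
Lemma AC_le0 a b h (eta : R) : 0 < eta -> AC a b h -> h a <= 0 ->
  for_aa `[a, b] (fun t => 0 < h t < eta ->
    exists2 l, is_derive t 1 h l & l <= 0) ->
  forall c, a <= c <= b -> h c <= 0.
Proof.
move=> eta0 ACh ha aah c /andP[ac cb]; rewrite leNgt; apply/negP => hc.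
pose A := [set s | a <= s <= c /\ h s <= 0].
have Aa : A a by split=> //; rewrite lexx.
have ubA : ubound A c by move=> s [/andP[]].
have supA : has_sup A by split; [exists a | exists c].
set s := sup A.
have as_ : a <= s by apply: ub_le_sup Aa; exists c.
have sc : s <= c by apply: ge_sup => //; exists a.
have hs : h s <= 0.
  rewrite leNgt; apply/negP => hs.
  have [d d0 hd] := AC_uniformly_continuous ACh hs.
  have [u [/andP[au uc] hu] su] := sup_adherent d0 supA.
  have us : u <= s by apply: ub_le_sup; [exists c | split=> //; rewrite au].
  have := hd u s au us ltac:(lra); rewrite -/s in su.
  rewrite ltr_norml => /(_ ltac:(lra)) /andP[? ?]; lra.
have [d d0 hd] := AC_uniformly_continuous ACh eta0.
pose v := Num.min c (s + d / 2).
have sv : s < v.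
  rewrite /v lt_min; apply/andP; split; last lra.
  by rewrite lt_neqAle sc andbT; apply/eqP => sE; move: hs; rewrite sE; lra.
have vc : v <= c by rewrite /v ge_min lexx.
have vd : v <= s + d / 2 by rewrite /v ge_min lexx orbT.
have hv : h v <= h s.
  apply: AC_le (ltW sv) _ _; first by apply: AC_subinterval ACh; lra.
  apply: for_aa_imply aah => t ht; rewrite /= in_itv/= => /andP[st tv].
  have tab : `[a, b]%classic t by rewrite /= in_itv/=; lra.
  apply: ht => //; apply/andP; split.
    rewrite ltNge; apply/negP => ht0; have : A t by split=> //; lra.
    by move/(ub_le_sup (ex_intro _ c ubA)); rewrite -/s; lra.
  have := hd s t as_ (ltW st) ltac:(lra) ltac:(lra).
  by rewrite ltr_norml => /andP[_]; lra.
have : A v by split; lra.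
by move/(ub_le_sup (ex_intro _ c ubA)); rewrite -/s leNgt sv.
Qed.

End comparison.

Section primitives.
Variable R : realType.
Local Notation mu := (@lebesgue_measure R).
Implicit Types (p q : R -> R) (s t : R).

Definition primitive p t := \int[mu]_(s in `]-oo, t]) p s.

Lemma integrable_itv p (i : interval R) :
  mu.-integrable setT (EFin \o p) -> mu.-integrable [set` i] (EFin \o p).
Proof. by move=> ip; apply: integrableS ip. Qed.

Lemma integrable_dominated p q : measurable_fun setT p ->
  mu.-integrable setT (EFin \o q) -> (forall t, `|p t| <= q t) ->
  mu.-integrable setT (EFin \o p).
Proof.
move=> mp iq pq; apply: le_integrable iq => //; first exact/measurable_EFinP.
by move=> t _ /=; rewrite lee_fin (le_trans (pq t))// ler_norm.
Qed.

Lemma primitiveB p s t : mu.-integrable setT (EFin \o p) -> s <= t ->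
  primitive p t - primitive p s = \int[mu]_(x in `]s, t[) p x.
Proof.
move=> ip st; rewrite /primitive Rintegral_itvB//; last exact: integrable_itv.
by rewrite Rintegral_itv_bndo_bndc//; exact: integrable_itv.
Qed.

Lemma ler_dist_primitive p q s t : mu.-integrable setT (EFin \o p) ->
  mu.-integrable setT (EFin \o q) -> (forall x, `|p x| <= q x) -> s <= t ->
  `|primitive p t - primitive p s| <= primitive q t - primitive q s.
Proof.
move=> ip iq pq st; rewrite !primitiveB//.
apply: le_trans (le_normr_Rintegral _ (integrable_itv _ ip)) _ => //.
apply: le_Rintegral => //; last exact: integrable_itv.
exact/integrable_norm/integrable_itv.
Qed.

Lemma primitive_uniformly_continuous q (e : R) :
  mu.-integrable setT (EFin \o q) -> (forall x, 0 <= q x) -> 0 < e ->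
  exists2 d, 0 < d & forall s t, s <= t -> t - s < d ->
    primitive q t - primitive q s < e.
Proof.
move=> iq q0 e0; have [d [d0 hd]] := integral_normr_continuous iq e0.
exists d => // s t st tsd; rewrite primitiveB//.
have -> : \int[mu]_(x in `]s, t[) q x = \int[mu]_(x in `]s, t[) `|q x|.
  by apply: eq_Rintegral => x _; rewrite ger0_norm.
apply: hd; first exact: measurable_itv.
rewrite [X in (X < _)%E](lebesgue_measure_itv `]s, t[) /=.
by case: ifP => _; rewrite ?lte_fin// -EFinB lte_fin.
Qed.

Lemma AC_primitive a b p : mu.-integrable setT (EFin \o p) ->
  AC a b (primitive p).
Proof.
move=> ip e e0.
have [d [d0 hd]] := integral_normr_continuous ip e0.
exists d => // n u v uv tuv suv.
pose F (i : 'I_n) : set R := `]u i, v i[%classic.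
have mF i : measurable (F i) by exact: measurable_itv.
pose U := \big[setU/set0]_(i < n) F i.
have mU : measurable U by exact: bigsetU_measurable.
have iap : mu.-integrable setT (EFin \o (fun x => `|p x|)).
  by have := integrable_norm ip.
have tF : trivIset [set` index_enum 'I_n] F.
  by apply: sub_trivIset tuv => i.
have UE : \int[mu]_(x in U) `|p x| = \sum_(i < n) \int[mu]_(x in F i) `|p x|.
  rewrite /Rintegral integral_bigsetU_EFin//=; last 2 first.
  - exact: index_enum_uniq.
  - by case/integrableP : iap => + _; exact: measurable_funS.
  rewrite -sum_fine// => i _.
  apply: integrable_fin_num; first exact: mF.
  exact: (integrable_itv `]u i, v i[ iap).
have muU : (mu U < d%:E)%E.
  rewrite measure_bigsetU_ord//.
  rewrite (_ : (\sum_(i < n) _)%E = (\sum_(i < n) (v i - u i))%:E) ?lte_fin//.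
  rewrite -sumEFin; apply: eq_bigr => i _.
  by have [_ uvi _] := uv i; rewrite [LHS]lebesgue_measure_itv/= lte_fin uvi.
apply: le_lt_trans (hd U mU muU); rewrite UE; apply: ler_sum => i _.
have [_ /ltW uvi _] := uv i.
rewrite primitiveB//; apply: le_normr_Rintegral => //; exact: integrable_itv.
Qed.

Lemma is_derive_primitive p : mu.-integrable setT (EFin \o p) ->
  {ae mu, forall t, is_derive t 1 (primitive p) (p t)}.
Proof.
move=> ip; have := @FTC1Ny R p (fun=> integrable_itv _ ip)
  (open_integrable_locally openT ip).
apply: (@filterS _ _ (ae_filter_ringOfSetsType _)) => t [dp pE].
by rewrite -pE derive1E; exact/derivableP.
Qed.

End primitives.

(** * Local suprema *)

Section local_suprema.
Context d (T : measurableType d) (R : realType).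
Implicit Types (g : T -> R -> R) (eta x y c : R) (t : T).

Definition window g eta t x := sup [set g t y | y in [set y | `|x - y| < eta]].

Section at_fixed_time.
Variables (g : T -> R -> R) (t : T).
Hypothesis cg : continuous (g t).

Lemma has_sup_window eta x : 0 < eta ->
  has_sup [set g t y | y in [set y | `|x - y| < eta]].
Proof.
move=> eta0; split; first by exists (g t x), x => //=; rewrite subrr normr0.
have xx : x - eta <= x + eta by lra.
have [c _ hc] := EVT_max xx (continuous_subspaceT cg).
exists (g t c) => _ [y /= xy <-]; apply: hc; rewrite in_itv/=.
by move: xy; rewrite ltr_norml => /andP[]; lra.
Qed.

Lemma le_window eta x y : `|x - y| < eta -> g t y <= window g eta t x.
Proof.
move=> xy; have eta0 : 0 < eta by apply: le_lt_trans xy.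
by apply: ub_le_sup; [exact: (has_sup_window x eta0).2 | exists y].
Qed.

Lemma window_le eta x c : 0 < eta ->
  (forall y, `|x - y| < eta -> g t y <= c) -> window g eta t x <= c.
Proof.
move=> eta0 gc; apply: ge_sup; first exact: (has_sup_window x eta0).1.
by move=> _ [y /= xy <-]; exact: gc.
Qed.

Lemma window_mono eta eta' x y : 0 < eta -> `|x - y| + eta <= eta' ->
  window g eta t x <= window g eta' t y.
Proof.
move=> eta0 xy; apply: window_le => // z xz; apply: le_window.
have := ler_distD x y z; rewrite (distrC y x); lra.
Qed.

Lemma window_norm_le eta x c : 0 < eta ->
  (forall y, `|g t y| <= c) -> `|window g eta t x| <= c.
Proof.
move=> eta0 gc; rewrite ler_norml; apply/andP; split.
  have := le_window (x := x) (y := x) (eta := eta).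
  rewrite subrr normr0 => /(_ eta0); apply: le_trans.
  by have := gc x; rewrite ler_norml => /andP[].
by apply: window_le => // y _; rewrite (le_trans (ler_norm _)).
Qed.

Lemma window_cvg (eta : R^nat) (u : R^nat) x : (forall n, 0 < eta n) ->
  eta @ \oo --> 0 -> u @ \oo --> x ->
  window g (eta n) t (u n) @[n --> \oo] --> g t x.
Proof.
move=> eta0 eta_cvg u_cvg; apply/cvgrPdist_le => e e0.
have /cvgrPdist_le/(_ e e0)/nbhs_ballP[r /= r0 gr] := cg (x := x).
have r20 : 0 < r / 2 by lra.
move/cvgrPdist_lt: u_cvg => /(_ _ r20) u_near.
move/cvgrPdist_lt: eta_cvg => /(_ _ r20) eta_near.
near=> n.
have un : `|x - u n| < r / 2 by near: n.
have en : `|0 - eta n| < r / 2 by near: n.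
rewrite sub0r normrN gtr0_norm// in en.
have near_x y : `|u n - y| < eta n -> g t x - e <= g t y <= g t x + e.
  move=> uy; have := gr y; rewrite /ball/= => /(_ _).
  have := ler_distD (u n) x y => tri /(_ ltac:(lra)).
  by rewrite ler_norml => /andP[]; lra.
rewrite ler_norml; apply/andP; split; last first.
  have := le_window (x := u n) (y := u n) (eta := eta n).
  rewrite subrr normr0 => /(_ (eta0 n)).
  have := near_x (u n); rewrite subrr normr0 => /(_ (eta0 n)) /andP[]; lra.
have : window g (eta n) t (u n) <= g t x + e by apply: window_le => // y /near_x /andP[].
lra.
Unshelve. all: by end_near. Qed.

End at_fixed_time.

(** By continuity a strict inequality [c < g t y] survives a small move of [y],
    so the supremum can be taken over the rationals. *)
Lemma measurable_window g eta (D : set T) (u : T -> R) : 0 < eta ->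
  (forall q : rat, measurable_fun D (fun t => g t (ratr q))) ->
  (forall t, D t -> continuous (g t)) ->
  measurable_fun D u -> measurable_fun D (fun t => window g eta t (u t)).
Proof.
move=> eta0 mg cg mu mD.
apply: (measurability _ (RGenOInfty.measurableE R)) => //.
move=> _ [_ [c ->] <-].
rewrite (_ : _ `&` _ = \bigcup_(q : rat)
  ((D `&` u @^-1` `]ratr q - eta, ratr q + eta[) `&`
   (D `&` (g ^~ (ratr q)) @^-1` `]c, +oo[))).
  apply: bigcupT_measurable_rat => q; apply: measurableI.
    by apply: mu => //; exact: measurable_itv.
  by apply: mg => //; exact: measurable_itv.
apply/seteqP; split => [t [Dt]|t [q _ [[Dt] /=]]] /=.
  rewrite in_itv/= andbT => /sup_gt[].
    exact: (has_sup_window (cg t Dt) (u t) eta0).1.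
  move=> _ [y /= uy <-] cy.
  have [r /= r0 gr] : \forall z \near y, c < g t z /\ `|u t - z| < eta.
    near=> z; split; near: z.
      by have /(_ y) /cvgr_gt/(_ _ cy) := cg t Dt.
    apply/nbhs_ballP; exists (eta - `|u t - y|); first by rewrite /= subr_gt0.
    by move=> z; rewrite /ball/= => yz; have := ler_distD y (u t) z; lra.
  have [q] := rat_in_itvoo (ltac:(lra) : y < y + r).
  rewrite in_itv/= => /andP[yq qr]; exists q => //.
  have [|cq uq] := gr (ratr q); first by rewrite /ball/= ltr_norml; lra.
  split; split=> //=; rewrite in_itv/= ?cq//.
  by move: uq; rewrite ltr_norml => /andP[]; lra.
rewrite !in_itv/= !andbT => /andP[? ?] [_ cq]; split=> //.
by apply: lt_le_trans cq (le_window (cg t Dt) _); rewrite ltr_norml; lra.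
Unshelve. all: by end_near. Qed.

(** The local suprema decrease to [g] itself, so that superposition with a
    measurable function preserves measurability. *)
Lemma measurable_superposition g (D : set T) (u : T -> R) :
  (forall q : rat, measurable_fun D (fun t => g t (ratr q))) ->
  (forall t, D t -> continuous (g t)) ->
  measurable_fun D u -> measurable_fun D (fun t => g t (u t)).
Proof.
move=> mg cg mu.
apply: (measurable_fun_cvg (h := fun n t => window g n.+1%:R^-1 t (u t))).
  by move=> n; exact: measurable_window.
move=> t Dt; apply: window_cvg => //; first exact: cg.
  exact: cvg_harmonic.
exact: cvg_cst.
Qed.

End local_suprema.

(** * The greatest solution of a scalar initial value problem *)

Section more_primitives.
Variable R : realType.
Local Notation mu := (@lebesgue_measure R).
Implicit Types (p q : R -> R) (s t x : R).

Lemma eq_primitive p q t : (forall s, s <= t -> p s = q s) ->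
  primitive p t = primitive q t.
Proof.
move=> pq; apply: eq_Rintegral => s; rewrite inE/= in_itv/=; exact: pq.
Qed.

Lemma primitive_eq0 p t : (forall s, s <= t -> p s = 0) -> primitive p t = 0.
Proof.
move=> p0; rewrite (@eq_primitive _ (cst 0))// /primitive /Rintegral.
by rewrite integral0_eq.
Qed.

Lemma norm_primitive_le p q t : mu.-integrable setT (EFin \o p) ->
  mu.-integrable setT (EFin \o q) -> (forall x, `|p x| <= q x) ->
  `|primitive p t| <= primitive q t.
Proof.
move=> ip iq pq.
apply: le_trans (le_normr_Rintegral _ (integrable_itv _ ip)) _ => //.
apply: le_Rintegral => //; last exact: integrable_itv.
exact/integrable_norm/integrable_itv.
Qed.

Lemma continuous_primitive p : mu.-integrable setT (EFin \o p) ->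
  continuous (primitive p).
Proof.
move=> ip t; apply/cvgrPdist_lt => e e0.
have inp : mu.-integrable setT (EFin \o (fun x => `|p x|)).
  by have := integrable_norm ip.
have [d d0 hd] := primitive_uniformly_continuous inp (fun x => normr_ge0 _) e0.
apply/nbhs_ballP; exists d => // s; rewrite /ball/= => ts.
have [st|ts'] := leP s t.
  apply: le_lt_trans (ler_dist_primitive ip inp _ st) _ => //.
  by apply: hd => //; rewrite (le_lt_trans (ler_norm _)).
rewrite distrC; apply: le_lt_trans (ler_dist_primitive ip inp _ (ltW ts')) _ => //.
by apply: hd; [exact: ltW|rewrite (le_lt_trans (ler_norm _))// distrC].
Qed.

Lemma AC_cst_primitive a b (x0 : R) p : mu.-integrable setT (EFin \o p) ->
  AC a b (fun t => x0 + primitive p t).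
Proof.
move=> ip e e0; have [d d0 H] := @AC_primitive R a b p ip e e0.
exists d => // n u v uv tuv suv.
by under eq_bigr do rewrite opprD addrACA subrr add0r; exact: H.
Qed.

Lemma is_derive_cst_primitive (x0 : R) p : mu.-integrable setT (EFin \o p) ->
  {ae mu, forall t, is_derive t 1 (fun t => x0 + primitive p t) (p t)}.
Proof.
move=> /is_derive_primitive.
apply: (@filterS _ _ (ae_filter_ringOfSetsType _)) => t pt.
rewrite -[p t]add0r; apply: is_deriveD.
Qed.

Lemma cvg_primitive (p_ : (R -> R)^nat) p q t :
  (forall n, measurable_fun setT (p_ n)) -> measurable_fun setT p ->
  (forall s, p_ n s @[n --> \oo] --> p s) ->
  mu.-integrable setT (EFin \o q) -> (forall n s, `|p_ n s| <= q s) ->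
  primitive (p_ n) t @[n --> \oo] --> primitive p t.
Proof.
move=> mp_ mp cvgp iq pq.
have mt : measurable (`]-oo, t]%classic : set R) by exact: measurable_itv.
have [|||||ip _ cvgI] := @dominated_convergence _ _ R mu _ mt
    (fun n s => (p_ n s)%:E) (EFin \o p) (EFin \o q).
- move=> n; apply/measurable_EFinP; apply: measurable_funTS; exact: mp_.
- by apply/measurable_EFinP; apply: measurable_funTS; exact: mp.
- by apply: aeW => s _; apply: cvg_EFin; [exact: nearW|exact: cvgp].
- exact: integrable_itv.
- by apply: aeW => s n _ /=; rewrite lee_fin.
apply: fine_cvg; rewrite fineK//.
exact: integrable_fin_num.
Qed.

End more_primitives.

Section scalar_ode.
Variable R : realType.
Local Notation mu := (@lebesgue_measure R).
Variables (g : R -> R -> R) (psi : R -> R) (a b : R).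
Hypothesis mg : forall q : rat, measurable_fun setT (fun t => g t (ratr q)).
Hypothesis cg : forall t, continuous (g t).
Hypothesis g_psi : forall t x, `|g t x| <= psi t.
Hypothesis ipsi : mu.-integrable setT (EFin \o psi).
Hypothesis psi_out : forall t, t <= a \/ b <= t -> psi t = 0.
Implicit Types (x y p : R -> R) (eta delta s t : R).

Let psi_ge0 t : 0 <= psi t.
Proof. by rewrite (le_trans _ (g_psi t 0)). Qed.

Let admissible p := measurable_fun setT p /\ forall t, `|p t| <= psi t.

Let integrable_admissible p : admissible p ->
  mu.-integrable setT (EFin \o p).
Proof. by move=> [mp ppsi]; exact: integrable_dominated ipsi _. Qed.

Let admissible_left p t : admissible p -> t <= a -> primitive p t = 0.
Proof.
move=> [_ ppsi] ta; apply: primitive_eq0 => s st; apply/normr0_eq0/le_anti.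
by rewrite normr_ge0 andbT -(psi_out (t := s))//; left; apply: le_trans ta.
Qed.

(** With a positive delay the equation can be integrated stretch by stretch:
    the [j]-th iterate of the integral operator is already correct up to time
    [a + j * delta], and nothing happens after time [b]. *)
Lemma delayed_solution (x0 : R) eta delta : 0 < eta -> 0 < delta ->
  exists x, let p s := window g eta s (x (s - delta)) in
    admissible p /\ forall t, x t = x0 + primitive p t.
Proof.
move=> eta0 delta0.
pose p x s := window g eta s (x (s - delta)).
pose X := fix X j := if j is i.+1 then fun t => x0 + primitive (p (X i)) t
                     else fun=> x0.
have adm x : continuous x -> admissible (p x).
  move=> cx; split; last by move=> t; apply: window_norm_le.
  apply: measurable_window => //.
  apply: continuous_measurable_fun => t; apply: continuous_comp; last exact: cx.
  by apply: cvgB; [exact: cvg_id|exact: cvg_cst].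
have cX j : continuous (X j).
  elim: j => [|j IH]; first by move=> t; exact: cvg_cst.
  move=> t; apply: cvgD; first exact: cvg_cst.
  exact/continuous_primitive/integrable_admissible/adm.
have Xstep j t : t <= a + j%:R * delta -> X j.+1 t = X j t.
  elim: j t => [|j IH] t ht.
    by rewrite /= admissible_left ?addr0//; [exact: adm (cX 0%N)|lra].
  rewrite [LHS]/= [RHS]/=; congr (_ + _); apply: eq_primitive => s st.
  by congr (window _ _ _ _); apply: IH; move: ht; rewrite -natr1 mulrDl; lra.
have [N hN] : exists N : nat, b <= a + N%:R * delta.
  exists (Num.trunc ((b - a) / delta)).+1.
  have := truncnS_gt ((b - a) / delta); rewrite ltr_pdivrMr//; lra.
exists (X N.+1); split; first exact/adm/cX.
move=> t; rewrite [LHS]/=; congr (_ + _); apply: eq_primitive => s _.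
have [sb|bs] := leP s b; first by rewrite Xstep//; lra.
have out x : continuous x -> p x s = 0.
  move=> /adm[_ /(_ s) H]; apply/normr0_eq0/le_anti.
  by rewrite normr_ge0 andbT (le_trans H)// psi_out//; right; exact: ltW.
by rewrite -/(p (X N.+1) s) !out.
Qed.

(** Solutions do not vary by more than [eta / 4] during a short delay, so the
    delayed equation brackets [p] between two local suprema at [x t]. *)
Lemma approximate_solution (x0 : R) eta : 0 < eta ->
  exists x, exists2 p, admissible p & forall t, x t = x0 + primitive p t /\
    window g (3 / 4 * eta) t (x t) <= p t <= window g (5 / 4 * eta) t (x t).
Proof.
move=> eta0; have eta40 : 0 < eta / 4 by lra.
have [d d0 hd] := primitive_uniformly_continuous ipsi psi_ge0 eta40.
have d20 : 0 < d / 2 by lra.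
have [x [adm xE]] := delayed_solution x0 eta0 d20.
exists x; eexists; first exact: adm.
move=> t; split; first exact: xE.
have near_x : `|x t - x (t - d / 2)| <= eta / 4.
  rewrite !xE opprD addrACA subrr add0r.
  have tt : t - d / 2 <= t by lra.
  apply: le_trans (ler_dist_primitive (integrable_admissible adm) ipsi adm.2 tt) _.
  by apply/ltW/hd => //; lra.
apply/andP; split; apply: window_mono => //; [lra|lra|].
by rewrite distrC; lra.
Qed.

(** While [y] exceeds [x] by less than [3 / 4 * eta - rho], the window of
    radius [rho] around [y t] lies in the window of radius [3 / 4 * eta] around
    [x t], so [y - x] cannot increase. *)
Lemma approximate_comparison (x0 : R) eta rho x p y c :
  admissible p -> (forall t, x t = x0 + primitive p t /\
    window g (3 / 4 * eta) t (x t) <= p t) ->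
  0 < rho -> rho < 3 / 4 * eta ->
  AC a c y -> y a <= x0 ->
  for_aa `[a, c] (fun t => exists2 l, is_derive t 1 y l &
    l <= window g rho t (y t)) ->
  forall t, a <= t <= c -> y t <= x t.
Proof.
move=> adm xp rho0 rhoeta ACy ya dy t tac.
have xE : x = (fun t => x0 + primitive p t) by apply/funext => s; case: (xp s).
rewrite -subr_le0.
apply: (@AC_le0 R a c (fun t => y t - x t) (3 / 4 * eta - rho)) tac; first lra.
- by apply: AC_sub => //; rewrite xE; exact/AC_cst_primitive/integrable_admissible.
- by rewrite xE admissible_left// addr0 subr_le0.
have dx : for_aa `[a, c] (fun t => is_derive t 1 x (p t)).
  have := is_derive_cst_primitive x0 (integrable_admissible adm); rewrite -xE.
  by apply: (@filterS _ _ (ae_filter_ringOfSetsType _)).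
apply: for_aa_imply (for_aaI dx dy) => s /[swap] sac /(_ sac)[dxs [l dys ly]].
move=> /andP[yx0 yx1]; exists (l - p s); first exact: is_deriveB.
rewrite subr_le0 (le_trans ly)//; apply: le_trans (xp s).2.
by apply: window_mono => //; rewrite gtr0_norm//; lra.
Qed.

(** Subsolutions stay below every approximate solution, and these decrease to a
    solution, which is therefore the greatest one. *)
Lemma greatest_ode_solution (x0 : R) : exists x,
  [/\ measurable_fun setT (fun t => g t (x t)),
      forall t, x t = x0 + primitive (fun s => g s (x s)) t
    & forall y c, AC a c y -> y a <= x0 ->
        for_aa `[a, c] (fun t => exists2 l, is_derive t 1 y l & l <= g t (y t)) ->
        forall t, a <= t <= c -> y t <= x t].
Proof.
(* The ratio 1/4 makes [5 / 4 * eta n.+1] smaller than [3 / 4 * eta n], so that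
   the approximate solutions are comparable and decrease. *)
pose eta n : R := 4^-1 ^+ n.
have eta0 n : 0 < eta n by rewrite exprn_gt0.
have etaS n : eta n.+1 = 4^-1 * eta n by rewrite /eta exprS.
pose XP n := cid (approximate_solution x0 (eta0 n)).
pose X n := projT1 (XP n).
pose PP n := cid2 (projT2 (XP n)).
pose p n := s2val (PP n).
have adm n : admissible (p n) by exact: (s2valP (PP n)).
have XE n t : X n t = x0 + primitive (p n) t by case: (s2valP' (PP n) t).
have pl n t : window g (3 / 4 * eta n) t (X n t) <= p n t.
  by case: (s2valP' (PP n) t) => _ /andP[].
have pu n t : p n t <= window g (5 / 4 * eta n) t (X n t).
  by case: (s2valP' (PP n) t) => _ /andP[].
have XpE n t : X n t = x0 + primitive (p n) t /\
    window g (3 / 4 * eta n) t (X n t) <= p n t by [].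
have Xdecr n t : X n.+1 t <= X n t.
  have [ta|/ltW at_] := leP t a; first by rewrite !XE !admissible_left.
  apply: (approximate_comparison (adm n) (XpE n) (rho := 5 / 4 * eta n.+1) (c := t)).
  - by have := eta0 n.+1; lra.
  - by rewrite etaS; have := eta0 n; lra.
  - rewrite (_ : X n.+1 = fun t => x0 + primitive (p n.+1) t); last exact/funext/XE.
    exact/AC_cst_primitive/integrable_admissible.
  - by rewrite XE admissible_left// addr0.
  - have := is_derive_cst_primitive x0 (integrable_admissible (adm n.+1)).
    rewrite (_ : (fun t => _) = X n.+1); last exact/esym/funext/XE.
    apply: (@filterS _ _ (ae_filter_ringOfSetsType _)) => s ds _.
    by exists (p n.+1 s).
  - by rewrite at_ lexx.
have Xbnd n t : x0 - primitive psi t <= X n t.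
  rewrite XE.
  have := norm_primitive_le t (integrable_admissible (adm n)) ipsi (adm n).2.
  by rewrite ler_norml => /andP[? ?]; lra.
pose x t := limn (fun n => X n t).
have Xx t : X n t @[n --> \oo] --> x t.
  apply: nonincreasing_is_cvgn; first exact/nonincreasing_seqP.
  by exists (x0 - primitive psi t) => _ [n _ <-].
have eta_cvg : eta @ \oo --> 0 by apply: cvg_expr; rewrite ger0_norm; lra.
have cvgp t : p n t @[n --> \oo] --> g t (x t).
  have scaled k : 0 < k -> window g (k * eta n) t (X n t) @[n --> \oo] --> g t (x t).
    move=> k0; apply: window_cvg; [exact: cg| | |exact: Xx].
      by move=> n; exact: mulr_gt0.
    by rewrite -(mulr0 k); apply: cvgM => //; exact: cvg_cst.
  have h34 : 0 < 3 / 4 :> R by lra.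
  have h54 : 0 < 5 / 4 :> R by lra.
  have := squeeze_cvgr _ (scaled _ h34) (scaled _ h54); apply.
  by near=> n; rewrite pl pu.
have mgx : measurable_fun setT (fun t => g t (x t)).
  by apply: (measurable_fun_cvg (h := p)) => [n|t _]; [exact: (adm n).1|].
exists x; split => //.
  move=> t; apply: (cvg_unique _ (Xx t)) => //.
  have -> : X ^~ t = (fun n => x0 + primitive (p n) t) by apply/funext => n.
  apply: cvgD; first exact: cvg_cst.
  by apply: cvg_primitive ipsi _ => // n; case: (adm n).
move=> y c ACy ya dy t tac; apply: limr_ge; first exact/cvg_ex/(ex_intro _ (x t)).
near=> n.
apply: (approximate_comparison (adm n) (XpE n) (rho := eta n / 2) ) ACy ya _ t tac.
- by have := eta0 n; lra.
- by have := eta0 n; lra.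
apply: for_aa_imply dy => s /[swap] sac /(_ sac)[l dl lg]; exists l => //.
rewrite (le_trans lg)//; apply: le_window => //.
by rewrite subrr normr0; have := eta0 n; lra.
Unshelve. all: by end_near. Qed.

End scalar_ode.

(** * From Lebesgue measurable to Borel measurable functions *)

Section borel_versions.
Variable R : realType.
Local Notation mu := (@lebesgue_measure R).
Local Notation completed_mu := (@completed_lebesgue_measure R).
Implicit Types (D N : set R) (h psi : R -> R) (a b : R).

Definition borel_null N := measurable N /\ mu N = 0%E.

Lemma borel_nullU N1 N2 : borel_null N1 -> borel_null N2 ->
  borel_null (N1 `|` N2).
Proof.
move=> [m1 n1] [m2 n2]; have mU := measurableU _ _ m1 m2; split=> //.
by apply/negligibleP => //; apply: negligibleU; exact/negligibleP.
Qed.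

Lemma borel_null1 a : borel_null [set a].
Proof. by split; [exact: measurable_set1|exact: lebesgue_measure_set1]. Qed.

Lemma borel_null_bigcup (T : countType) (N : T -> set R) :
  (forall i, borel_null (N i)) -> borel_null (\bigcup_i N i).
Proof.
move=> N0.
pose F n := if unpickle n is Some i then N i else set0.
have F0 n : borel_null (F n).
  by rewrite /F; case: unpickle => // ; split; rewrite ?measure0.
have -> : \bigcup_i N i = \bigcup_n F n.
  apply/seteqP; split=> x [i _ xi].
    by exists (pickle i) => //; rewrite /F pickleK.
  by move: xi; rewrite /F; case: unpickle => // j xj; exists j.
have mF : measurable (\bigcup_n F n).
  by apply: bigcupT_measurable => n; case: (F0 n).
split => //; apply/negligibleP => //; apply: negligible_bigcup => n.
by apply/negligibleP; case: (F0 n).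
Qed.

Lemma for_aa_borel D P : for_aa D P ->
  exists2 N, borel_null N & forall t, D t -> ~ N t -> P t.
Proof.
move=> [N [mN N0 subN]]; exists N => // t Dt Nt.
by apply: contrapT => Pt; apply/Nt/subN => /= /(_ Dt).
Qed.

Lemma borel_for_aa D P N : borel_null N -> (forall t, D t -> ~ N t -> P t) ->
  for_aa D P.
Proof.
move=> [mN N0] H; exists N; split => // t /= nP.
by apply: contrapT => Nt; apply: nP => Dt; exact: H.
Qed.

Lemma borel_lebesgue_measurable (A : set R) : measurable A ->
  measurable (A : set (lebesgueType R)).
Proof. exact: sub_caratheodory. Qed.

Lemma lebesgue_measurable_borel (A : set R) :
  measurable (A : set (lebesgueType R)) ->
  exists2 N, borel_null N & measurable (A `\` N).
Proof.
rewrite -[measurable _]/((_.-cara.-measurable : set (set _)) A).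
rewrite -completed_caratheodory_measurable g_sigma_completed_algebra_genE.
move=> [B mB [M [N [mN N0 MN]] <-]]; exists N => //.
rewrite setDUl (_ : M `\` N = set0) ?setU0; last by rewrite setD_eq0.
exact: measurableD.
Qed.

Lemma lebesgue_measurable_fun_borel D h : measurable D ->
  lebesgue_measurable_fun D h ->
  exists2 N, borel_null N & measurable_fun (D `\` N) h.
Proof.
move=> mD mh.
have /choice[N N0] (q : rat) : exists N, borel_null N /\
    measurable ((D `&` h @^-1` `]ratr q, +oo[) `\` N).
  have := mh (borel_lebesgue_measurable mD) `]ratr q, +oo[%classic (measurable_itv _).
  by move=> /lebesgue_measurable_borel[N ? ?]; exists N.
have U0 : borel_null (\bigcup_q N q) by apply: borel_null_bigcup => q; case: (N0 q).
exists (\bigcup_q N q) => //.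
set M := \bigcup_q N q; move=> mDN.
apply: (measurability _ (RGenOInfty.measurableE R)) => //.
move=> _ [_ [c ->] <-].
rewrite (_ : _ `&` _ = \bigcup_(q : rat) (if c < ratr q then
  (D `&` h @^-1` `]ratr q, +oo[) `\` N q `\` M else set0)).
  apply: bigcupT_measurable_rat => q; case: ifP => // _.
  by apply: measurableD; [exact: (N0 q).2 | exact: U0.1].
apply/seteqP; split => [t [[Dt Mt] /=]|t [q _]].
  rewrite in_itv/= andbT => /rat_in_itvoo[q]; rewrite in_itv/= => /andP[cq qh].
  exists q => //; rewrite cq; split => //; split.
    by split=> //=; rewrite in_itv/= qh.
  by move=> Nt; apply: Mt; exists q.
case: ifP => // cq [[[Dt /=]]]; rewrite !in_itv/= !andbT => qh _ Mt.
by split => //; exact: lt_trans qh.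
Qed.

Lemma integrable_completed_borel psi : measurable_fun setT psi ->
  completed_mu.-integrable setT (EFin \o psi) ->
  mu.-integrable setT (EFin \o psi).
Proof.
move=> mpsi /integrableP[_ ipsi]; apply/integrableP; split.
  exact/measurable_EFinP.
pose id' : lebesgueType R -> measurableTypeR R := idfun.
have mid : measurable_fun setT id'.
  by move=> _ B mB; rewrite setTI; exact: borel_lebesgue_measurable.
apply: le_lt_trans ipsi.
rewrite (eq_measure_integral (pushforward completed_mu id')) => [|A mA _ //].
rewrite ge0_integral_pushforward //.
by apply: measurableT_comp => //; exact/measurable_EFinP.
Qed.

Lemma lebesgue_measurable_countable_borel (T : countType) D (F : T -> R -> R) :
  measurable D -> (forall i, lebesgue_measurable_fun D (F i)) ->
  exists2 N, borel_null N & forall i, measurable_fun (D `\` N) (F i).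
Proof.
move=> mD mF.
have /choice[N N0] i : exists N, borel_null N /\ measurable_fun (D `\` N) (F i).
  by have [N ? ?] := lebesgue_measurable_fun_borel mD (mF i); exists N.
exists (\bigcup_i N i); first by apply: borel_null_bigcup => i; case: (N0 i).
move=> i; have [[mN _] mFi] := N0 i; apply: measurable_funS mFi.
  exact: measurableD.
by apply: setDS => t Nt; exists i.
Qed.

(** [psi'] is the absolute value of [psi], set to [0] off the open interval and
    on a Borel null set outside which [psi] is Borel measurable. *)
Lemma L1_borel_dominator a b psi : L1 `[a, b] psi ->
  exists psi' : R -> R, [/\ mu.-integrable setT (EFin \o psi'),
    forall t, 0 <= psi' t, forall t, t <= a \/ b <= t -> psi' t = 0
    & for_aa `[a, b] (fun t => psi t <= psi' t)].
Proof.
move=> ipsi; have [/measurable_EFinP mpsi _] := integrableP _ _ _ ipsi.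
have [||N N0 mN] := @lebesgue_measurable_fun_borel `[a, b] psi.
- exact: measurable_itv.
- exact: mpsi.
have mE : measurable (`]a, b[ `\` N).
  by apply: measurableD; [exact: measurable_itv|exact: N0.1].
pose psi' := (fun t => `|psi t|) \_ (`]a, b[ `\` N).
have mpsi' : measurable_fun setT psi'.
  apply/(measurable_restrictT _ mE).
  apply: measurableT_comp; first exact: normr_measurable.
  apply: measurable_funS mN.
    by apply: measurableD; [exact: measurable_itv|exact: N0.1].
  by apply: setSD; exact: subset_itv_oo_cc.
have psi'_le t : `|psi' t| <= `|psi t|.
  by rewrite /psi' patchE; case: ifP => _; rewrite ?normr_id ?normr0.
have ab_out t : t <= a \/ b <= t -> psi' t = 0.
  move=> tab; rewrite /psi' patchE memNset// => -[/=]; rewrite in_itv/= => /andP[]; lra.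
exists psi'; split => //.
- apply: integrable_completed_borel => //.
  have mab : measurable (`[a, b]%classic : set (lebesgueType R)).
    by apply: borel_lebesgue_measurable; exact: measurable_itv.
  have := (@integrable_mkcond _ (lebesgueType R) R (@completed_lebesgue_measure R)
    `[a, b] (EFin \o psi') mab).1; rewrite restrict_EFin.
  have -> : psi' \_ `[a, b] = psi'.
    apply/funext => t; rewrite patchE; case: ifPn => //.
    rewrite notin_setE/= in_itv/= => /negP tab; rewrite ab_out//.
    by move: tab; rewrite negb_and -!ltNge => /orP[]; [left|right]; exact: ltW.
  apply; apply: le_integrable ipsi => //.
    apply/measurable_EFinP; apply: measurable_funTS.
    by move=> _ B mB; apply: borel_lebesgue_measurable; exact: mpsi'.
  by move=> t _ /=; rewrite lee_fin.
- by move=> t; rewrite /psi' patchE; case: ifP.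
- apply: (borel_for_aa (borel_nullU N0 (borel_nullU (borel_null1 a) (borel_null1 b)))).
  move=> t /=; rewrite in_itv/= => /andP[at_ tb] /not_orP[Nt /not_orP[ta tb']].
  rewrite /psi' patchE mem_set ?ler_norm//; split=> //=; rewrite in_itv/=.
  rewrite !lt_neqAle at_ tb !andbT.
  by apply/andP; split; apply/eqP => tE; [apply: ta|apply: tb'] => /=.
Qed.

(** Continuity in the space variable lets the countably many functions
    [g ^~ q] with [q] rational control all the others, so that a single null set
    can be removed. *)
Lemma borel_version D psi (g : R -> R -> R) : measurable D ->
  (forall x, lebesgue_measurable_fun D (g ^~ x)) ->
  (forall t, D t -> continuous (g t)) ->
  (forall t x, D t -> `|g t x| <= psi t) -> (forall t, 0 <= psi t) ->
  exists g' : R -> R -> R,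
    [/\ forall q : rat, measurable_fun setT (fun t => g' t (ratr q)),
        forall t, continuous (g' t), forall t x, `|g' t x| <= psi t
      & for_aa D (fun t => g' t = g t)].
Proof.
move=> mD mg cg g_psi psi0.
have [N N0 mN] := @lebesgue_measurable_countable_borel rat D
  (fun q t => g t (ratr q)) mD (fun q => mg (ratr q)).
have mDN : measurable (D `\` N) by apply: measurableD => //; exact: N0.1.
pose g' t x := if t \in D `\` N then g t x else 0.
exists g'; split.
- move=> q; have mgq : measurable_fun setT ((fun t => g t (ratr q)) \_ (D `\` N)).
    by apply/(measurable_restrictT _ mDN); exact: mN.
  by apply: eq_measurable_fun mgq => t _; rewrite /patch.
- move=> t; rewrite /g'.
  case: (boolP (t \in _)) => [|_]; last exact: cst_continuous.
  by rewrite inE => -[Dt _]; exact: cg.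
- move=> t x; rewrite /g'; case: ifPn => [|_]; last by rewrite normr0.
  by rewrite inE => -[Dt _]; exact: g_psi.
- apply: (borel_for_aa N0) => t Dt Nt; apply/funext => x.
  by rewrite /g' mem_set.
Qed.


End borel_versions.

(** * The problem with a prescribed functional argument *)

Section function_lemmas.
Variable R : realType.
Implicit Types (J D N : set R) (a b t : R) (h w : R -> R).

Lemma AC_ext a b (g h : R -> R) : (forall t, a <= t <= b -> g t = h t) ->
  AC a b g -> AC a b h.
Proof.
move=> gh ACg e /ACg[d d0 H]; exists d => // n u v uv tuv suv.
under eq_bigr => i _.
  have [au uvi vb] := uv i.
  rewrite -gh ?au ?vb ?(le_trans au (ltW uvi))//.
  by rewrite -gh ?au ?(le_trans (ltW uvi) vb)//; over.
exact: H.
Qed.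

Lemma for_aa_interior a b N P : borel_null N ->
  for_aa (`]a, b[ `\` N) P -> for_aa `[a, b] P.
Proof.
move=> N0 /for_aa_borel[M M0 H].
apply: (borel_for_aa (borel_nullU (borel_nullU N0 M0)
  (borel_nullU (borel_null1 a) (borel_null1 b)))).
move=> t /=; rewrite in_itv/= => /andP[at_ tb] /not_orP[/not_orP[Nt Mt] /not_orP[ta tb']].
apply: H => //; split=> //=; rewrite in_itv/= !lt_neqAle at_ tb !andbT.
by apply/andP; split; apply/eqP => tE; [apply: ta|apply: tb'] => /=.
Qed.

Lemma Cont_measurable J D h : measurable J -> measurable D -> D `<=` J ->
  Cont J h -> lebesgue_measurable_fun D h.
Proof.
move=> mJ mD DJ Ch _ B mB; apply: borel_lebesgue_measurable.
by apply: (measurable_funS mJ DJ (subspace_continuous_measurable_fun mJ Ch)).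
Qed.

Lemma Cont_modulus J w (m1 m2 : R -> R) : continuous m1 -> continuous m2 ->
  (forall s t, J s -> J t -> `|w t - w s| <= `|m1 t - m1 s| + `|m2 t - m2 s|) ->
  Cont J w.
Proof.
move=> c1 c2 H; apply/subspace_continuousP => t Jt; apply/cvgrPdist_lt => e e0.
have e20 : 0 < e / 2 by lra.
rewrite near_withinE; near=> s => Js.
apply: le_lt_trans (H s t Js Jt) _.
have : `|m1 t - m1 s| < e / 2.
  by near: s; have /cvgrPdist_lt := c1 t; apply.
have : `|m2 t - m2 s| < e / 2.
  by near: s; have /cvgrPdist_lt := c2 t; apply.
lra.
Unshelve. all: by end_near. Qed.

Definition clamp a b t := Num.max a (Num.min t b).

Lemma clamp_itv a b t : a <= b -> a <= clamp a b t <= b.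
Proof.
by move=> ab; rewrite /clamp le_max lexx/= ge_max ab/= ge_min lexx orbT.
Qed.

Lemma clamp_id a b t : a <= t <= b -> clamp a b t = t.
Proof.
by move=> /andP[at_ tb]; rewrite /clamp (min_idPl tb) (max_idPr at_).
Qed.

Lemma clamp_ge a b t : a <= b -> b <= t -> clamp a b t = b.
Proof. by move=> ab bt; rewrite /clamp (min_idPr bt) (max_idPr ab). Qed.

Lemma clamp_continuous a b : continuous (clamp a b).
Proof.
move=> t; apply: (@continuous_max R R (cst a) (fun s => Num.min s b)).
  exact: cst_continuous.
by apply: (@continuous_min R R id (cst b)); [exact: cvg_id|exact: cst_continuous].
Qed.

Lemma Cont_clamp a b h : a <= b -> Cont `[a, b] h ->
  continuous (h \o clamp a b).
Proof.
move=> ab /subspace_continuousP Ch t.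
have clab s : `[a, b]%classic (clamp a b s) by rewrite /= in_itv/= clamp_itv.
apply: cvg_comp (Ch _ (clab t)) => U /= HU.
have Ucl := @clamp_continuous a b t _ HU.
change (nbhs t (clamp a b @^-1` U)).
by apply: (@filterS R (nbhs t) _ _ _ _ Ucl) => s /= /(_ (clab s)).
Qed.

End function_lemmas.

Section decoupled_problem.
Variables (R : realType) (t0 r L : R) (hr : 0 <= r).
Local Notation mu := (@lebesgue_measure R).
Local Notation I0 := (I_zero t0 L).
Local Notation Im := (I_minus t0 r).
Local Notation I := (I_all t0 r L).
Variables (f : R -> R -> R -> R) (tau k alpha beta psi : R -> R).
Variable Lam : (R -> R) -> R.
Hypothesis mf : forall x y, lebesgue_measurable_fun I0 (fun t => f t x y).
Hypothesis cf : for_aa I0 (fun t =>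
  (forall y, continuous (fun x => f t x y)) /\ forall x, continuous (f t x)).
Hypothesis tauI : forall t, I0 t -> I (tau t).
Hypothesis mtau : lebesgue_measurable_fun I0 tau.
Hypothesis Ck : Cont Im k.
Hypothesis Calpha : Cont I alpha.
Hypothesis Cbeta : Cont I beta.
Hypothesis alpha_beta : le_on I alpha beta.
Hypothesis ACalpha : AC t0 (t0 + L) alpha.
Hypothesis ACbeta : AC t0 (t0 + L) beta.
Hypothesis dalpha : for_aa I0 (fun t => exists2 l,
  is_derive t 1 alpha l & l <= f t (alpha t) (alpha (tau t))).
Hypothesis dbeta : for_aa I0 (fun t => exists2 l,
  is_derive t 1 beta l & f t (beta t) (beta (tau t)) <= l).
Hypothesis alpha_init : forall gamma, order_interval I alpha beta gamma ->
  forall t, Im t -> alpha t <= Lam gamma + k t.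
Hypothesis beta_init : forall gamma, order_interval I alpha beta gamma ->
  forall t, Im t -> Lam gamma + k t <= beta t.
Hypothesis ipsi : mu.-integrable setT (EFin \o psi).
Hypothesis psi_ge0 : forall t, 0 <= psi t.
Hypothesis psi_out : forall t, t <= t0 \/ t0 + L <= t -> psi t = 0.
Hypothesis f_psi : for_aa I0 (fun t => forall x y, alpha t <= x <= beta t ->
  alpha (tau t) <= y <= beta (tau t) -> `|f t x y| <= psi t).
Hypothesis f_nondecr : forall t x y1 y2, I0 t -> y1 <= y2 ->
  f t x y1 <= f t x y2.

Let I0I : I0 `<=` I. Proof. by move=> t; right. Qed.
Let Im_t0 : Im t0.
Proof. by rewrite /I_minus /= in_itv/= lexx andbT gerBl. Qed.
Let measurable_I : measurable I.
Proof. by apply: measurableU; exact: measurable_itv. Qed.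

Let kk := k \o clamp (t0 - r) t0.

Let kk_continuous : continuous kk.
Proof. by apply: Cont_clamp Ck; rewrite gerBl. Qed.

(** The common modulus of continuity of all the functions that the decoupled
    problem produces; it does not depend on [gamma]. *)
Definition tame (y : R -> R) := forall s t, I s -> I t ->
  `|y t - y s| <= `|kk t - kk s| + `|primitive psi t - primitive psi s|.

Lemma tame_Cont y : tame y -> Cont I y.
Proof.
by move=> ty; apply: Cont_modulus ty => //; exact: continuous_primitive.
Qed.

(** Clamping the space variable between [alpha] and [beta] turns the local bound
    on [f] into a global one and changes nothing on the order interval. *)
Lemma decoupled_right_hand_side gamma : order_interval I alpha beta gamma ->
  exists g : R -> R -> R,
    [/\ forall q : rat, measurable_fun setT (fun t => g t (ratr q)),
        forall t, continuous (g t), forall t x, `|g t x| <= psi t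
      & for_aa I0 (fun t => forall x,
          g t x = f t (clamp (alpha t) (beta t) x) (gamma (tau t)))].
Proof.
move=> [Cgamma alpha_gamma gamma_beta].
have [N [mN N0] Ncf] := for_aa_borel (for_aaI cf f_psi).
pose D : set R := `]t0, t0 + L[ `\` N.
have mD : measurable D by apply: measurableD => //; exact: measurable_itv.
have DI0 : D `<=` I0.
  by move=> t [/= + _]; rewrite /I_zero /= !in_itv/= => /andP[/ltW-> /ltW->].
have DI : D `<=` I by move=> t /DI0/I0I.
have mD' := borel_lebesgue_measurable mD.
have mgt : lebesgue_measurable_fun D (gamma \o tau).
  apply: (@measurable_comp _ _ _ (lebesgueType R) _ _ I) => //.
  - by move=> _ [t /DI0 It <-]; exact: tauI.
  - exact: subspace_continuous_measurable_fun.
  - apply: measurable_funS mtau => //.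
    by apply: borel_lebesgue_measurable; exact: measurable_itv.
have mfx x y : lebesgue_measurable_fun D (fun t => f t x y).
  apply: measurable_funS (mf x y) => //.
  by apply: borel_lebesgue_measurable; exact: measurable_itv.
have mfg x : lebesgue_measurable_fun D (fun t => f t x (gamma (tau t))).
  apply: (measurable_superposition (T := lebesgueType R) (D := D)
    (g := fun t => f t x)) => // [q|]; first exact: mfx.
  by move=> t Dt; have [[_ +] _] := Ncf t (DI0 _ Dt) Dt.2; apply.
pose cl x t := clamp (alpha t) (beta t) x.
have mcl x : lebesgue_measurable_fun D (cl x).
  apply: measurable_maxr; first exact: (Cont_measurable measurable_I).
  apply: measurable_minr; first exact: measurable_cst.
  exact: (Cont_measurable measurable_I).
have [|x|t Dt x|t x Dt|//|g [mg cg g_psi gE]] :=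
    @borel_version R D psi (fun t x => f t (cl x t) (gamma (tau t))).
- exact: mD.
- apply: (measurable_superposition (T := lebesgueType R) (D := D)
    (g := fun t x => f t x (gamma (tau t)))) => [q|t Dt|].
  + exact: mfg.
  + by have [[+ _] _] := Ncf t (DI0 _ Dt) Dt.2; apply.
  + exact: mcl.
- have [[cft _] _] := Ncf t (DI0 _ Dt) Dt.2.
  apply: (@continuous_comp _ _ _ (clamp (alpha t) (beta t))
    (fun z => f t z (gamma (tau t)))).
    exact: clamp_continuous.
  exact: cft.
- apply: (Ncf t (DI0 _ Dt) Dt.2).2.
    by apply: clamp_itv; exact/alpha_beta/DI.
  have It := tauI (DI0 _ Dt).
  by rewrite alpha_gamma//= gamma_beta.
exists g; split=> //.
apply: (for_aa_interior (N := N)) => //.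
by apply: for_aa_imply gE => t H /H -> .
Qed.

Definition decoupled_solution gamma y :=
  [/\ order_interval I alpha beta y, tame y, AC t0 (t0 + L) y,
      forall t, Im t -> y t = Lam gamma + k t
    & for_aa I0 (fun t => is_derive t 1 y (f t (y t) (gamma (tau t))))].

(** The solution of the clamped problem stays between [alpha], one of its
    subsolutions, and [beta]: above [beta] the clamped right-hand side is the one
    at height [beta], which the derivative of [beta] dominates. *)
Lemma greatest_decoupled_solution gamma : order_interval I alpha beta gamma ->
  exists2 y, decoupled_solution gamma y &
    forall z, order_interval I alpha beta z -> AC t0 (t0 + L) z ->
      (forall t, Im t -> z t <= Lam gamma + k t) ->
      for_aa I0 (fun t => exists2 l, is_derive t 1 z l &
        l <= f t (z t) (gamma (tau t))) ->
      le_on I z y.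
Proof.
move=> gammaI; have [Cgamma alpha_gamma gamma_beta] := gammaI.
have [g [mg cg g_psi gE]] := decoupled_right_hand_side gammaI.
have [x [mgx xE x_greatest]] :=
  greatest_ode_solution mg cg g_psi ipsi psi_out (Lam gamma + k t0).
pose p s := g s (x s); rewrite -/p in mgx xE.
have p_psi s : `|p s| <= psi s by exact: g_psi.
have ip : mu.-integrable setT (EFin \o p).
  by apply: integrable_dominated ipsi _ => [|t]; [exact: mgx|exact: g_psi].
have p0 t : t <= t0 -> primitive p t = 0.
  move=> tt0; apply: primitive_eq0 => s st; apply/normr0_eq0/le_anti.
  by rewrite normr_ge0 andbT -(psi_out (t := s)) ?g_psi//; left; apply: le_trans tt0.
pose y t := Lam gamma + kk t + primitive p t.
have yx t : t0 <= t -> y t = x t.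
  by move=> tt0; rewrite /y /kk /= clamp_ge ?gerBl// xE.
have yIm t : Im t -> y t = Lam gamma + k t.
  rewrite /I_minus/= in_itv/= => tI.
  by rewrite /y p0 ?addr0 /kk/= ?clamp_id//; case/andP: tI.
have I0_ge t : I0 t -> t0 <= t by rewrite /I_zero/= in_itv/= => /andP[].
have xt0 : x t0 = Lam gamma + k t0 by rewrite xE p0// addr0.
have xE' : x = (fun t => Lam gamma + k t0 + primitive p t) by apply/funext.
have ACx : AC t0 (t0 + L) x.
  by rewrite xE'; exact: AC_cst_primitive.
have dx : for_aa I0 (fun t => is_derive t 1 x
    (f t (clamp (alpha t) (beta t) (x t)) (gamma (tau t)))).
  have := is_derive_cst_primitive (Lam gamma + k t0) ip.
  rewrite -xE' => dxp; apply: for_aa_imply (for_aaI gE (_ : for_aa I0 _)).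
    by move=> t H It; have [gEt] := H It; rewrite -gEt; exact.
  by apply: (@filterS _ _ (ae_filter_ringOfSetsType _)) dxp => t + _; exact.
have x_below z : order_interval I alpha beta z -> AC t0 (t0 + L) z ->
    z t0 <= Lam gamma + k t0 ->
    for_aa I0 (fun t => exists2 l, is_derive t 1 z l &
      l <= f t (z t) (gamma (tau t))) -> le_on I0 z x.
  move=> [_ alpha_z z_beta] ACz zt0 dz t; rewrite /I_zero/= in_itv/=.
  apply: x_greatest => //; apply: for_aa_imply (for_aaI gE dz) => s H Is.
  have [gEs [l dl lf]] := H Is; exists l => //.
  by rewrite gEs clamp_id// alpha_z ?z_beta//; exact: I0I.
have alphaI : order_interval I alpha beta alpha by split.
have alpha_x : le_on I0 alpha x.
  apply: x_below => //; first exact: alpha_init.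
  apply: for_aa_imply dalpha => t H It; have [l dl lf] := H It.
  by exists l => //; rewrite (le_trans lf)// f_nondecr//; exact/alpha_gamma/tauI.
have x_beta : le_on I0 x beta.
  move=> t; rewrite /I_zero/= in_itv/= => tI; rewrite -subr_le0.
  apply: (@AC_le0 R t0 (t0 + L) (fun t => x t - beta t) 1 ltr01 _ _ _ t tI).
  - exact: AC_sub.
  - by rewrite /= subr_le0 xt0 beta_init.
  apply: for_aa_imply (for_aaI dx dbeta) => s H Is /andP[xb _].
  have [dxs [l dl fl]] := H Is.
  eexists; first exact: is_deriveB dxs dl.
  rewrite subr_le0; apply: le_trans fl; rewrite clamp_ge.
  - by apply: f_nondecr => //; exact/gamma_beta/tauI.
  - exact/alpha_beta/I0I.
  - lra.
have ty : tame y.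
  move=> s t _ _; rewrite /y.
  have -> : Lam gamma + kk t + primitive p t - (Lam gamma + kk s + primitive p s) =
    (kk t - kk s) + (primitive p t - primitive p s) by lra.
  apply: le_trans (ler_normD _ _) _; rewrite lerD2l.
  have [st|/ltW ts] := leP s t.
    by apply: le_trans (ler_dist_primitive ip ipsi p_psi st) (ler_norm _).
  rewrite distrC [leRHS]distrC.
  by apply: le_trans (ler_dist_primitive ip ipsi p_psi ts) (ler_norm _).
have yI : order_interval I alpha beta y.
  split; first exact: tame_Cont.
    move=> t [tIm|tI0]; first by rewrite yIm//; exact: alpha_init.
    by rewrite yx ?I0_ge//; exact: alpha_x.
  move=> t [tIm|tI0]; first by rewrite yIm//; exact: beta_init.
  by rewrite yx ?I0_ge//; exact: x_beta.
exists y; first split => //.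
- by apply: AC_ext ACx => t /andP[tt0 _]; rewrite yx.
- apply: (for_aa_interior (borel_null1 t0)).
  apply: for_aa_imply dx => t H [/= tI _].
  have tI0 : I0 t by move: tI; rewrite /I_zero/= !in_itv/= => /andP[/ltW-> /ltW->].
  have := H tI0; rewrite clamp_id ?alpha_x ?x_beta// -yx ?I0_ge//.
  apply: near_eq_is_derive; near=> s; rewrite yx//.
  apply/ltW; near: s; apply: lt_nbhsr.
  by move: tI; rewrite in_itv/= => /andP[].
move=> z zI ACz z_init dz t [tIm|tI0]; first by rewrite yIm//; exact: z_init.
by rewrite yx ?I0_ge//; apply: x_below => //; exact: z_init.
Unshelve. all: by end_near. Qed.


(** * The greatest fixed point *)

Hypothesis Lam_nondecr :
  operator_nondecreasing_in I Lam (order_interval I alpha beta).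

(** Knaster-Tarski: the solution operator [G] of the decoupled problem is monotone
    and has tame values, tameness passes to pointwise suprema, so the supremum
    [w] of the tame subsolutions is itself one, and [G w = w]. *)
Lemma greatest_solution :
  exists x, is_greatest I
    (solution t0 r L f tau Lam k `&` order_interval I alpha beta) x.
Proof.
have /choice[G Gspec] gamma : exists y, order_interval I alpha beta gamma ->
    decoupled_solution gamma y /\
    forall z, order_interval I alpha beta z -> AC t0 (t0 + L) z ->
      (forall t, Im t -> z t <= Lam gamma + k t) ->
      for_aa I0 (fun t => exists2 l, is_derive t 1 z l &
        l <= f t (z t) (gamma (tau t))) ->
      le_on I z y.
  have [gammaI|ngammaI] := pselect (order_interval I alpha beta gamma).
    by have [y ? ?] := greatest_decoupled_solution gammaI; exists y.
  by exists gamma.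
have GI gamma : order_interval I alpha beta gamma ->
  order_interval I alpha beta (G gamma) by move=> /Gspec[[]].
have G_mono g1 g2 : order_interval I alpha beta g1 ->
    order_interval I alpha beta g2 -> le_on I g1 g2 -> le_on I (G g1) (G g2).
  move=> g1I g2I g12; have [[G1I _ AC1 init1 d1] _] := Gspec _ g1I.
  apply: (Gspec _ g2I).2 => //.
    by move=> t tIm; rewrite init1// lerD2r; exact: Lam_nondecr.
  apply: for_aa_imply d1 => t H It; eexists; first exact: H.
  by apply: f_nondecr => //; exact/g12/tauI.
have alphaI : order_interval I alpha beta alpha by split.
pose A := [set w | [/\ order_interval I alpha beta w, tame w & le_on I w (G w)]].
have GA gamma : order_interval I alpha beta gamma -> le_on I gamma (G gamma) ->
    A (G gamma).
  move=> gammaI gG; have [[? ? _ _ _] _] := Gspec _ gammaI; split=> //.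
  exact: G_mono (GI _ gammaI) gG.
have AGalpha : A (G alpha).
  by apply: GA => //; have [] := GI _ alphaI.
pose w t := sup [set u t | u in A].
have supA t : I t -> has_sup [set u t | u in A].
  move=> It; split; first by exists (G alpha t), (G alpha).
  by exists (beta t) => _ [u [[_ _ uB] _ _] <-]; exact: uB.
have Aw u : A u -> le_on I u w.
  by move=> Au t It; apply: ub_le_sup; [exact: (supA t It).2|exists u].
have w_le t c : I t -> (forall u, A u -> u t <= c) -> w t <= c.
  move=> It H; apply: ge_sup; first exact: (supA t It).1.
  by move=> _ [u Au <-]; exact: H.
have tame_w : tame w.
  have half s t : I s -> I t ->
      w t - w s <= `|kk t - kk s| + `|primitive psi t - primitive psi s|.
    move=> Is It; rewrite lerBlDr; apply: w_le => // u Au.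
    have [_ /(_ s t Is It) + _] := Au; have := Aw u Au s Is.
    move=> us; have := ler_norm (u t - u s); lra.
  move=> s t Is It; rewrite ler_norml half// andbT lerNl opprB.
  by rewrite [X in _ <= X + _]distrC [X in _ <= _ + X]distrC half.
have wI : order_interval I alpha beta w.
  split; first exact: tame_Cont.
    move=> t It; apply: le_trans (Aw _ AGalpha t It).
    by have [_ + _] := GI _ alphaI; apply.
  by move=> t It; apply: w_le => // u [[_ _ +] _ _]; apply.
have w_Gw : le_on I w (G w).
  move=> t It; apply: w_le => // u Au; have [uI _ uG] := Au.
  by apply: le_trans (uG t It) _; apply: G_mono => //; exact: Aw.
have Gw_w : le_on I (G w) w by exact/Aw/GA.
have GwE t : I t -> G w t = w t.
  by move=> It; apply/le_anti; rewrite Gw_w// w_Gw.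
have [[GwI tGw ACGw GwIm dGw] _] := Gspec _ wI.
exists (G w); split.
  split=> //; split=> //.
  - by case: GwI.
  - apply: for_aa_imply dGw => t H It.
    by rewrite [G w (tau t)]GwE; [exact: H|exact: tauI].
  - move=> t tIm; rewrite GwIm//; congr (_ + _); apply/le_anti/andP.
    by split; apply: Lam_nondecr.
move=> y [[Cy ACy dy yIm] yI] t It.
have y_Gy : le_on I y (G y).
  apply: (Gspec _ yI).2 => //; first by move=> s sIm; rewrite yIm.
  by apply: for_aa_imply dy => s H Is; eexists; first exact: H.
by rewrite GwE// (le_trans (y_Gy t It))//; apply: Aw => //; exact: GA.
Qed.

End decoupled_problem.

(** * Reflection: least solutions are negated greatest solutions *)

Section reflection.
Variable R : realType.
Implicit Types (J D : set R) (h g k : R -> R).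

Definition opp_fun h : R -> R := fun t => - h t.
Definition opp_rhs (f : R -> R -> R -> R) : R -> R -> R -> R :=
  fun t x y => - f t (- x) (- y).
Definition opp_operator (Lam : (R -> R) -> R) : (R -> R) -> R :=
  fun g => - Lam (opp_fun g).

Lemma opp_funK : involutive opp_fun.
Proof. by move=> h; apply/funext => t; rewrite /opp_fun opprK. Qed.

Lemma opp_rhsK : involutive opp_rhs.
Proof.
by move=> f; apply/funext => t; apply/funext => x; apply/funext => y;
  rewrite /opp_rhs !opprK.
Qed.

Lemma opp_operatorK : involutive opp_operator.
Proof.
by move=> Lam; apply/funext => g; rewrite /opp_operator opp_funK opprK.
Qed.

Lemma le_on_opp J g h : le_on J g h -> le_on J (opp_fun h) (opp_fun g).
Proof. by move=> gh t Jt; rewrite lerN2 gh. Qed.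

Lemma Cont_opp J h : Cont J h -> Cont J (opp_fun h).
Proof. by move=> Ch t; apply: cvgN; exact: Ch. Qed.

Lemma AC_opp a b h : AC a b h -> AC a b (opp_fun h).
Proof.
move=> ACh e /ACh[d d0 H]; exists d => // n u v uv tuv suv.
by under eq_bigr do rewrite /opp_fun -opprB normrN opprK addrC; exact: H.
Qed.

Lemma lebesgue_measurable_fun_opp D h : lebesgue_measurable_fun D h ->
  lebesgue_measurable_fun D (opp_fun h).
Proof. exact: measurable_funN. Qed.

Lemma continuous_opp_opp h : continuous h -> continuous (fun x => - h (- x)).
Proof.
move=> ch x; apply: cvgN; apply: (@continuous_comp _ _ _ -%R h).
  exact: opp_continuous.
exact: ch.
Qed.

Lemma order_interval_opp J a b g : order_interval J a b g ->
  order_interval J (opp_fun b) (opp_fun a) (opp_fun g).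
Proof.
by move=> [Cg ag gb]; split; [exact: Cont_opp|exact: le_on_opp|exact: le_on_opp].
Qed.

Lemma solution_opp t0 r L f tau Lam k x : solution t0 r L f tau Lam k x ->
  solution t0 r L (opp_rhs f) tau (opp_operator Lam) (opp_fun k) (opp_fun x).
Proof.
move=> [Cx ACx dx xIm]; split.
- exact: Cont_opp.
- exact: AC_opp.
- apply: for_aa_imply dx => t H It.
  by rewrite /opp_rhs/opp_fun !opprK; apply: is_deriveN; exact: H.
- by move=> t tIm; rewrite /opp_operator opp_funK /opp_fun xIm// opprD.
Qed.

Lemma is_least_opp t0 r L f tau Lam k alpha beta x :
  let I := I_all t0 r L in
  is_greatest I (solution t0 r L (opp_rhs f) tau (opp_operator Lam) (opp_fun k)
    `&` order_interval I (opp_fun beta) (opp_fun alpha)) x ->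
  is_least I (solution t0 r L f tau Lam k `&` order_interval I alpha beta)
    (opp_fun x).
Proof.
move=> I [[sx xI] x_greatest]; split.
  split.
    have := solution_opp sx.
    by rewrite opp_rhsK opp_operatorK opp_funK.
  have := order_interval_opp xI.
  by rewrite !opp_funK.
move=> y [sy yI]; rewrite -[y]opp_funK; apply: le_on_opp.
by apply: x_greatest; split; [exact: solution_opp|exact: order_interval_opp].
Qed.

End reflection.

Theorem theorem2p2 (R : realType) (t0 r L : R) (hL : 0 < L) (hr : 0 <= r)
  (I0 := I_zero t0 L) (Im := I_minus t0 r) (I := I_all t0 r L)
  (f : R -> R -> R -> R) (hf : caratheodory I f)
  (tau : R -> R) (htau : forall t, I0 t -> I (tau t))
  (Lam : (R -> R) -> R) (hLam : operator_on I Lam)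
  (k : R -> R) (hk : Cont Im k)
  (alpha beta : R -> R)
  (h1 : lower_upper_solutions t0 r L f tau Lam k alpha beta)
  (E := E_set tau alpha beta)
  (h2a_meas : forall m M, is_min (alpha @` I) m -> is_max (beta @` I) M ->
     forall x y : R, m <= x <= M -> m <= y <= M ->
       lebesgue_measurable_fun I (fun t => f t x y))
  (h2a_cont : for_aa I0 (fun t =>
     forall x y : R, alpha t <= x <= beta t -> E t y ->
       continuous (fun z => f t z y) /\ continuous (fun z => f t x z)))
  (h2b : lebesgue_measurable_fun I0 tau)
  (h2c : operator_continuous I Lam)
  (h3 : exists2 psi : R -> R, L1 I0 psi &
     for_aa I0 (fun t =>
       forall x y : R, alpha t <= x <= beta t -> E t y -> `|f t x y| <= psi t))
  (h4_f : forall t x y1 y2 : R, I t -> y1 <= y2 -> f t x y1 <= f t x y2)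
  (h4_Lam : operator_nondecreasing_in I Lam (order_interval I alpha beta)) :
  let S := solution t0 r L f tau Lam k `&` order_interval I alpha beta in
  (exists x, is_greatest I S x) /\ (exists x, is_least I S x).
Proof.
have I0I : I0 `<=` I by move=> t; right.
have mI : measurable (I : set (lebesgueType R)).
  by apply: borel_lebesgue_measurable; apply: measurableU; exact: measurable_itv.
have mf x y : lebesgue_measurable_fun I0 (fun t => f t x y).
  by apply: measurable_funS (hf.1 x y).
have cf : for_aa I0 (fun t =>
    (forall y, continuous (fun x => f t x y)) /\ forall x, continuous (f t x)).
  apply: for_aa_imply hf.2 => t H /I0I/H ct; split => [y x|x y].
    apply: (@continuous_comp _ _ _ (fun z => (z, y)) (fun p => f t p.1 p.2)).
      exact: (cvg_pair cvg_id (cvg_cst y)).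
    exact: ct.
  apply: (@continuous_comp _ _ _ (fun z => (x, z)) (fun p => f t p.1 p.2)).
    exact: (cvg_pair (cvg_cst x) cvg_id).
  exact: ct.
have [[Ca Cb ab] [ACa ACb] [Lam_lb Lam_ub] [da a_init] [db b_init]] := h1.
have atau t : I0 t -> alpha (tau t) <= beta (tau t) by move=> /htau; exact: ab.
have dalpha : for_aa I0 (fun t => exists2 l,
    is_derive t 1 alpha l & l <= f t (alpha t) (alpha (tau t))).
  apply: for_aa_imply da => t H It; have [dt [m [_ m_lb] md]] := H It.
  exists (derive1 alpha t); first by rewrite derive1E; exact/derivableP.
  apply: le_trans md (m_lb _ _); exists (alpha (tau t)) => //.
  by rewrite /E_set /= in_itv/= lexx atau.
have dbeta : for_aa I0 (fun t => exists2 l,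
    is_derive t 1 beta l & f t (beta t) (beta (tau t)) <= l).
  apply: for_aa_imply db => t H It; have [dt [m [_ m_ub] md]] := H It.
  exists (derive1 beta t); first by rewrite derive1E; exact/derivableP.
  apply: le_trans (m_ub _ _) md; exists (beta (tau t)) => //.
  by rewrite /E_set /= in_itv/= lexx atau.
have alpha_init g : order_interval I alpha beta g ->
    forall t, Im t -> alpha t <= Lam g + k t.
  move=> gI t /a_init ht; apply: le_trans ht _; rewrite lerD2r.
  by apply: ge_inf => //; exists g.
have beta_init g : order_interval I alpha beta g ->
    forall t, Im t -> Lam g + k t <= beta t.
  move=> gI t /b_init ht; apply: le_trans ht; rewrite lerD2r.
  by apply: ub_le_sup => //; exists g.
have [psi0 ipsi0 f_psi0] := h3.
have [psi [ipsi psi_ge0 psi_out psi0_psi]] := L1_borel_dominator ipsi0.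
have f_psi : for_aa I0 (fun t => forall x y, alpha t <= x <= beta t ->
    alpha (tau t) <= y <= beta (tau t) -> `|f t x y| <= psi t).
  apply: for_aa_imply (for_aaI f_psi0 psi0_psi) => t H It x y xI yI.
  by have [fp] := H It; apply: le_trans; exact: fp.
have f_nondecr t x y1 y2 : I0 t -> y1 <= y2 -> f t x y1 <= f t x y2.
  by move=> /I0I; exact: h4_f.
split; first exact: (@greatest_solution _ t0 r L hr f tau k alpha beta psi Lam).
have oppI g : order_interval I (opp_fun beta) (opp_fun alpha) g ->
    order_interval I alpha beta (opp_fun g).
  by move=> /order_interval_opp; rewrite !opp_funK.
suff [x xP] : exists x, is_greatest I
    (solution t0 r L (opp_rhs f) tau (opp_operator Lam) (opp_fun k)
     `&` order_interval I (opp_fun beta) (opp_fun alpha)) x.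
  by exists (opp_fun x); exact: is_least_opp.
apply: (@greatest_solution _ t0 r L hr _ tau _ _ _ psi) => //.
- by move=> x y; apply: lebesgue_measurable_fun_opp; exact: mf.
- apply: for_aa_imply cf => t H It; have [c1 c2] := H It.
  split=> [y|x]; first exact: (continuous_opp_opp (c1 (- y))).
  exact: (continuous_opp_opp (c2 (- x))).
- exact: Cont_opp.
- exact: Cont_opp.
- exact: Cont_opp.
- exact: le_on_opp.
- exact: AC_opp.
- exact: AC_opp.
- apply: for_aa_imply dbeta => t H It; have [l dl fl] := H It.
  by exists (- l); [exact: is_deriveN|rewrite /opp_rhs /opp_fun !opprK lerN2].
- apply: for_aa_imply dalpha => t H It; have [l dl fl] := H It.
  by exists (- l); [exact: is_deriveN|rewrite /opp_rhs /opp_fun !opprK lerN2].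
- move=> g /oppI/beta_init H t /H.
  by rewrite /opp_operator/opp_fun; lra.
- move=> g /oppI/alpha_init H t /H.
  by rewrite /opp_operator/opp_fun; lra.
- apply: for_aa_imply f_psi => t H It x y; rewrite /opp_fun /opp_rhs normrN.
  by move=> /andP[? ?] /andP[? ?]; apply: H => //; lra.
- by move=> t x y1 y2 It y12; rewrite lerN2 f_nondecr// lerN2.
- move=> g1 g2 /oppI g1I /oppI g2I g12; rewrite lerN2.
  by apply: h4_Lam => //; exact: le_on_opp.
Qed.
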